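(* Let $K$ be a field and let $e\ge 4$ be an integer. The numerical semigroup $$S_e=\langle i : e\le i\le 2e-1,\ i\ne e+2,\ i\neq e+3\rangle$$ is a Sally semigroup of multiplicity $e$. In particular, Sally semigroups exist for any given multiplicity $e\ge 4$.
   Context: A numerical semigroup is a subsemigroup $H\subset\mathbb{N}$ with $0\in H$; $\langle\cdots\rangle$ denotes the subsemigroup of $\mathbb N$ (containing $0$) generated by the listed integers. $K[[H]]\subset K[[t]]$ is the complete semigroup ring of $H$, i.e. the completion of $K[H]=K[t^h: h\in H]$ at the ideal generated by all $t^h$ with $0\neq h\in H$; it is a one-dimensional local ring. A numerical semigroup $H$ is called a Sally semigroup if $K[[H]]$ is a Gorenstein ring whose embedding dimension $r$, dimension $d=1$ and multiplicity $e$ satisfy $r=e+d-3=e-2$. The multiplicity of a Sally semigroup is the multiplicity $e$ of the local ring $K[[H]]$. *)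

(* Defs.v *)
From HB Require Import structures.
From mathcomp Require Import all_boot all_order all_algebra.
From mathcomp Require Import boolp classical_sets functions.

Set Implicit Arguments.
Unset Strict Implicit.
Unset Printing Implicit Defensive.

Import GRing.Theory.

Local Open Scope classical_set_scope.
Local Open Scope ring_scope.

(** * Numerical semigroups *)

(* No finiteness of the complement is required: a numerical semigroup is any
   subsemigroup of nat containing 0. *)
Record numerical_semigroup := NumericalSemigroup {
  ns_set :> nat -> Prop;
  ns_mem0 : ns_set 0%N;
  ns_memD : forall a b, ns_set a -> ns_set b -> ns_set (a + b)%N }.

Definition generated_set (A : set nat) : set nat :=
  [set n | exists s : seq nat, (forall a, a \in s -> A a) /\ n = sumn s].

Lemma generated_mem0 (A : set nat) : generated_set A 0%N.
Proof. by exists [::]. Qed.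

Lemma generated_memD (A : set nat) (a b : nat) :
  generated_set A a -> generated_set A b -> generated_set A (a + b)%N.
Proof.
move=> [s [sA ->]] [t [tA ->]]; exists (s ++ t); split; last by rewrite sumn_cat.
by move=> x; rewrite mem_cat => /orP[/sA|/tA].
Qed.

Definition generated_semigroup (A : set nat) : numerical_semigroup :=
  NumericalSemigroup (@generated_mem0 A) (@generated_memD A).

Definition S_ (e : nat) : numerical_semigroup :=
  generated_semigroup
    [set i | (e <= i <= 2 * e - 1)%N /\ i <> (e + 2)%N /\ i <> (e + 3)%N].

(** * Formal power series *)

(* [f : fps K] is the series [\sum_n f n t^n].  The alias keeps the Cauchy
   product apart from the pointwise product carried by [nat -> K]. *)
Definition fps (K : fieldType) : Type := nat -> K.

HB.instance Definition _ (K : fieldType) :=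
  GRing.Zmodule.copy (fps K) (nat -> K).

Section FpsRing.
Variable K : fieldType.
Implicit Types f g h : fps K.

Definition fps_one : fps K := fun n => (n == 0%N)%:R.

Definition fps_mul f g : fps K := fun n => \sum_(i < n.+1) f i * g (n - i)%N.

Let trunc (N : nat) f : {poly K} := \poly_(i < N) f i.

Lemma fps_mul_trunc N f g n : (n < N)%N ->
  fps_mul f g n = (trunc N f * trunc N g)`_n.
Proof.
move=> nN; rewrite coefM; apply: eq_bigr => i _.
by rewrite !coef_poly !(leq_ltn_trans _ nN) ?leq_subr // -ltnS.
Qed.

Lemma fps_mulC : commutative fps_mul.
Proof.
by move=> f g; apply/funext => n; rewrite !(@fps_mul_trunc n.+1) // mulrC.
Qed.

Lemma fps_mulA : associative fps_mul.
Proof.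
move=> f g h; apply/funext => n.
have trM f1 f2 i : (i < n.+1)%N ->
    (trunc n.+1 (fps_mul f1 f2))`_i = (trunc n.+1 f1 * trunc n.+1 f2)`_i.
  by move=> iN; rewrite coef_poly iN (@fps_mul_trunc n.+1).
rewrite !(@fps_mul_trunc n.+1) //.
transitivity (trunc n.+1 f * (trunc n.+1 g * trunc n.+1 h))`_n.
  rewrite !coefM; apply: eq_bigr => i _.
  by rewrite trM // ltnS leq_subr.
rewrite mulrA !coefM; apply: eq_bigr => i _.
by rewrite trM.
Qed.

Lemma fps_mul1 : left_id fps_one fps_mul.
Proof.
move=> f; apply/funext => n; rewrite /fps_mul big_ord_recl /= mul1r subn0.
by rewrite big1 ?addr0 // => i _; rewrite /fps_one /= mul0r.
Qed.

Lemma fps_mulDl : left_distributive fps_mul +%R.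
Proof.
move=> f g h; apply/funext => n; rewrite /fps_mul.
transitivity (\sum_(i < n.+1) (f i * h (n - i)%N + g i * h (n - i)%N)).
  by apply: eq_bigr => i _; rewrite -mulrDl.
by rewrite big_split.
Qed.

Lemma fps_one_neq0 : fps_one != 0.
Proof.
apply/eqP => /(congr1 (fun f : fps K => f 0%N)) /eqP.
by rewrite /fps_one eqxx (negbTE (oner_neq0 K)).
Qed.

HB.instance Definition _ := GRing.Zmodule_isComNzRing.Build (fps K)
  fps_mulA fps_mulC fps_mul1 fps_mulDl fps_one_neq0.

End FpsRing.

(** * Complete semigroup rings *)

Section SemigroupRing.
Variables (K : fieldType) (H : numerical_semigroup).

Definition supported : {pred fps K} :=
  fun f => `[< forall n, ~ H n -> f n = 0 >].

Lemma supported_subring : subring_closed supported.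
Proof.
split.
- apply/asboolP => -[|n] nH; last by [].
  by case: nH; exact: ns_mem0.
- move=> f g /asboolP fH /asboolP gH; apply/asboolP => n nH.
  have -> : (f - g) n = f n - g n by [].
  by rewrite fH // gH // subrr.
- move=> f g /asboolP fH /asboolP gH; apply/asboolP => n nH.
  apply: big1 => i _.
  have [Hi|/fH ->] := pselect (H i); last by rewrite mul0r.
  rewrite (gH (n - i)%N) ?mulr0 // => Hni; apply: nH.
  by rewrite -(@subnKC i n) -1?ltnS //; exact: ns_memD.
Qed.

HB.instance Definition _ :=
  GRing.isSubringClosed.Build (fps K) supported supported_subring.

(* K[[H]] inside K[[t]]: the completion of K[H] at (t^h : 0 <> h \in H) is the
   ring of the series all of whose exponents lie in H. *)
Record semigroup_ring := SemigroupRing {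
  sr_fps :> fps K;
  sr_supported : sr_fps \in supported }.

HB.instance Definition _ := [isSub for sr_fps].
HB.instance Definition _ := [Choice of semigroup_ring by <:].
HB.instance Definition _ := [SubChoice_isSubComNzRing of semigroup_ring by <:].

End SemigroupRing.

(** * Ideals *)

Section Ideals.
Variable R : comNzRingType.
Implicit Types I J P : set R.

Definition ideal I : Prop :=
  I 0 /\ forall a x y : R, I x -> I y -> I (a * x + y).

Definition prime_ideal P : Prop :=
  [/\ ideal P, ~ P 1 & forall x y : R, P (x * y) -> P x \/ P y].

Definition maximal_ideal I : Prop :=
  [/\ ideal I, ~ I 1 & forall J, ideal J -> I `<` J -> J = setT].

Definition ideal_gen (A : set R) : set R :=
  [set x | exists (n : nat) (a g : 'I_n -> R),
     (forall i, A (g i)) /\ x = \sum_(i < n) a i * g i].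

Definition ideal_pow I (n : nat) : set R :=
  ideal_gen [set x | exists g : 'I_n -> R,
     (forall i, I (g i)) /\ x = \prod_(i < n) g i].

Definition noetherian : Prop :=
  forall I, ideal I -> exists s : seq R, I = ideal_gen [set x | x \in s].

Definition local_ring_with (m : set R) : Prop :=
  maximal_ideal m /\ forall m', maximal_ideal m' -> m' = m.

Definition prime_chain (n : nat) (C : nat -> set R) : Prop :=
  (forall i, (i <= n)%N -> prime_ideal (C i)) /\
  (forall i, (i < n)%N -> C i `<` C i.+1).

Definition krull_dim (d : nat) : Prop :=
  (exists C, prime_chain d C) /\
  (forall n C, prime_chain n C -> (n <= d)%N).

(* The R-module R/I has length n: there is a composition series of length n,
   written as a chain of ideals from I to R. *)
Definition quotient_length I (n : nat) : Prop :=
  exists C : nat -> set R,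
    [/\ C 0%N = I, C n = setT, forall i, (i <= n)%N -> ideal (C i) &
        forall i, (i < n)%N -> C i `<` C i.+1 /\
          forall J, ideal J -> C i `<=` J -> J `<=` C i.+1 ->
            J = C i \/ J = C i.+1].

(* The classes of x_1, .., x_r form a basis of the R/m-vector space m/m^2. *)
Definition embedding_dim (r : nat) : Prop :=
  exists m, local_ring_with m /\
  exists x : 'I_r -> R,
    [/\ forall i, m (x i),
        forall y, m y -> exists a : 'I_r -> R,
          ideal_pow m 2 (y - \sum_(i < r) a i * x i) &
        forall a : 'I_r -> R,
          ideal_pow m 2 (\sum_(i < r) a i * x i) -> forall i, m (a i)].

(* Hilbert-Samuel: length (R/m^(n+1)) = P(n) for n large, where P has degree
   d = dim R and leading coefficient e / d!. *)
Definition multiplicity (e : nat) : Prop :=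
  exists m d, [/\ local_ring_with m, krull_dim d &
  exists P : {poly rat},
    [/\ size P = d.+1,
        d`!%:R * lead_coef P = e%:R &
        exists N, forall n, (N <= n)%N ->
          exists2 l : nat, quotient_length (ideal_pow m n.+1) l
                         & l%:R = P.[n%:R]]].

End Ideals.

Arguments noetherian : clear implicits.
Arguments krull_dim : clear implicits.
Arguments embedding_dim : clear implicits.
Arguments multiplicity : clear implicits.

(** * Gorenstein local rings *)

Section Injective.
Variable R : comNzRingType.

Definition injective_module (E : lmodType R) : Prop :=
  forall (M N : lmodType R) (i : {linear M -> N}) (f : {linear M -> E}),
    injective i -> exists g : {linear N -> E}, forall x, g (i x) = f x.

(* 0 -> M -> E 0 -> E 1 -> ... is exact with all E i injective. *)
Definition injective_resolution (M : lmodType R) (E : nat -> lmodType R)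
    (eps : {linear M -> E 0%N}) (d : forall i, {linear E i -> E i.+1}) : Prop :=
  [/\ forall i, injective_module (E i),
      injective eps,
      forall y, d 0%N y = 0 <-> exists x, y = eps x &
      forall i y, d i.+1 y = 0 <-> exists x, y = d i x].

Definition finite_injective_dim (M : lmodType R) : Prop :=
  exists (E : nat -> lmodType R) (eps : {linear M -> E 0%N})
         (d : forall i, {linear E i -> E i.+1}),
    injective_resolution eps d /\
    exists n : nat, forall i, (n < i)%N -> forall y : E i, y = 0.

End Injective.

Definition gorenstein_local_ring (R : comNzRingType) : Prop :=
  [/\ noetherian R, exists m : set R, local_ring_with m
    & finite_injective_dim (R^o : lmodType R)].

(** * Sally semigroups *)

Definition sally_semigroup (K : fieldType) (H : numerical_semigroup) : Prop :=
  gorenstein_local_ring (semigroup_ring K H) /\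
  exists r d e : nat,
    [/\ embedding_dim (semigroup_ring K H) r,
        krull_dim (semigroup_ring K H) d,
        multiplicity (semigroup_ring K H) e,
        d = 1%N &
        (r + 3 = e + d)%N].

Definition semigroup_multiplicity (K : fieldType) (H : numerical_semigroup)
    (e : nat) : Prop :=
  multiplicity (semigroup_ring K H) e.

(* Main.v *)
From HB Require Import structures.
Require Import Defs.
From mathcomp Require Import all_boot all_order all_algebra.
From mathcomp Require Import boolp classical_sets functions.
From mathcomp Require Import zify.
From mathcomp Require generic_quotient.

(* [S_e] consists of [0] and of all [n >= e] other than [e + 2], [e + 3] and
   [2e + 3]; it is symmetric with Frobenius number [F = 2e + 3].  Symmetry gives
   the Gorenstein property: the pairing [(x, q) |-> res (x q)], where [res] is
   the coefficient of [t^F], identifies [K((t)) / R] with the module of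
   continuous functionals on [R = K[[S_e]]], so that
   [0 -> R -> K((t)) -> dual -> 0] is an injective resolution, both terms being
   injective by Baer's criterion.  Since [e >= 4], every [k >= n e] of [S_e] is a
   sum of [n] nonzero elements of [S_e] and one more element, so [m^n] is the
   ideal of the series of order at least [n e]; hence [t^g], for the [e - 2]
   generators [g], form a basis of [m / m^2], and [R / m^(n+1)] has length
   [(n + 1) e - (e + 2) = n e - 2] for large [n]. *)

Set Implicit Arguments.
Unset Strict Implicit.
Unset Printing Implicit Defensive.

Import GRing.Theory.

Local Open Scope classical_set_scope.
Local Open Scope ring_scope.

(** * Formal power series *)

Section PowerSeries.
Variable K : fieldType.
Implicit Types f g : fps K.

Definition ord_ge (n : nat) f := forall i, (i < n)%N -> f i = 0.

Lemma fpsM f g n : (f * g) n = \sum_(i < n.+1) f i * g (n - i)%N.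
Proof. by []. Qed.

Lemma fpsB f g n : (f - g) n = f n - g n.
Proof. by []. Qed.

Lemma fpsD f g n : (f + g) n = f n + g n.
Proof. by []. Qed.

Lemma fps1 n : (1 : fps K) n = (n == 0%N)%:R.
Proof. by []. Qed.

Lemma fps_sum I (r : seq I) (P : pred I) (F : I -> fps K) n :
  (\sum_(i <- r | P i) F i) n = \sum_(i <- r | P i) F i n.
Proof. exact: (big_morph (fun f : fps K => f n)). Qed.

Lemma ord_ge_le m n f : (m <= n)%N -> ord_ge n f -> ord_ge m f.
Proof. by move=> mn fn i im; apply: fn; apply: leq_trans mn. Qed.

Lemma ord_geD n f g : ord_ge n f -> ord_ge n g -> ord_ge n (f + g).
Proof. by move=> fn gn i im; rewrite fpsD fn ?gn ?addr0. Qed.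

Lemma ord_geM m n f g : ord_ge m f -> ord_ge n g -> ord_ge (m + n) (f * g).
Proof.
move=> fm gn k kmn; rewrite fpsM big1 // => i _.
have [im|mi] := ltnP i m; first by rewrite fm ?mul0r.
rewrite gn ?mulr0 //; case: i mi => i /= ik mi; rewrite ltnS in ik.
by rewrite ltn_subLR // (leq_trans kmn) // leq_add2r.
Qed.

Lemma fpsM_lead m n f g : ord_ge m f -> ord_ge n g ->
  (f * g) (m + n)%N = f m * g n.
Proof.
move=> fm gn; rewrite fpsM.
have lm : (m < (m + n).+1)%N by rewrite ltnS leq_addr.
rewrite (bigD1 (Ordinal lm)) //= addKn big1 ?addr0 // => i /eqP neq.
have [im|] := ltnP i m; first by rewrite fm ?mul0r.
rewrite leq_eqVlt => /orP[/eqP mi|mi]; first by case: neq; apply: val_inj.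
rewrite gn ?mulr0 //; case: i mi {neq} => i /= ik mi; rewrite ltnS in ik.
by rewrite ltn_subLR // ltn_add2r.
Qed.

Lemma ord_ex f : f <> 0 -> exists n, f n != 0 /\ ord_ge n f.
Proof.
move=> f0; have ex : exists n, f n != 0.
  apply: contrapT => nex; apply: f0; apply/funext => n.
  by apply/eqP; apply/negPn/negP => fn; apply: nex; exists n.
exists (ex_minn ex); case: ex_minnP => n fn minn; split=> // i lin.
by apply/eqP/negPn/negP => /minn; rewrite leqNgt lin.
Qed.

(** * Constants, monomials and inverses of power series *)

Definition fpsC (c : K) : fps K := fun n => if n == 0%N then c else 0.
Definition fpsX (k : nat) : fps K := fun n => (n == k)%:R.

Lemma ord_geX k : ord_ge k (fpsX k).
Proof. by move=> i ik; rewrite /fpsX ltn_eqF. Qed.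

Lemma fpsCM c f n : (fpsC c * f) n = c * f n.
Proof.
rewrite fpsM big_ord_recl /= subn0 big1 ?addr0 // => i _.
by rewrite /fpsC /= mul0r.
Qed.

Lemma fpsXM k f n : (fpsX k * f) n = if (k <= n)%N then f (n - k)%N else 0.
Proof.
have [kn|nk] := leqP k n; last first.
  by rewrite (ord_geM (@ord_geX k) (n := 0) (g := f)) // addn0.
rewrite fpsM; have lk : (k < n.+1)%N by [].
rewrite (bigD1 (Ordinal lk)) //= /fpsX eqxx mul1r big1 ?addr0 // => i /negbTE.
by rewrite -val_eqE /= => ->; rewrite mul0r.
Qed.

Lemma fpsX0 : fpsX 0 = 1.
Proof. by []. Qed.

Lemma fpsXD a b : fpsX (a + b) = fpsX a * fpsX b.
Proof.
apply/funext => n; rewrite fpsXM /fpsX; case: leqP => h.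
  by rewrite -{1}(subnKC h) eqn_add2l.
by rewrite ltn_eqF // (leq_trans h) // leq_addr.
Qed.

Lemma ord_ge_factor k f : ord_ge k f -> f = fpsX k * (fun n => f (k + n)%N).
Proof.
move=> fk; apply/funext => n; rewrite fpsXM; case: leqP => h.
  by rewrite subnKC.
exact: fk.
Qed.

(* The inverse of [1 - g] for [g] of positive order: only the powers of exponent
   at most [n] contribute to the coefficient of [t^n]. *)
Definition fps_geom g : fps K := fun n => (\sum_(k < n.+1) g ^+ k) n.

Lemma ord_ge_exp g k : g 0%N = 0 -> ord_ge k (g ^+ k).
Proof.
move=> g0; elim: k => [|k IH] //.
by rewrite exprS -add1n; apply: ord_geM => // -[|].
Qed.

Lemma fps_geom_trunc g N n : g 0%N = 0 -> (n < N)%N ->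
  fps_geom g n = (\sum_(k < N) g ^+ k) n.
Proof.
move=> g0 nN; rewrite /fps_geom; move: N nN.
elim=> // N IH; rewrite ltnS leq_eqVlt => /orP[/eqP -> //|nN].
by rewrite [in RHS]big_ord_recr /= fpsD -IH // (ord_ge_exp (k := N)) ?addr0.
Qed.

Lemma fps_geomP g : g 0%N = 0 -> (1 - g) * fps_geom g = 1.
Proof.
move=> g0; apply/funext => n.
transitivity (((1 - g) * \sum_(k < n.+1) g ^+ k) n).
  rewrite !fpsM; apply: eq_bigr => i _.
  by rewrite (@fps_geom_trunc g n.+1) // ltnS leq_subr.
by rewrite -(opprB g) mulNr -subrX1 opprB fpsB (ord_ge_exp (k := n.+1)) ?subr0.
Qed.

(** Writing [f = c (1 - g)], with [c] the constant term, reduces inversion to a geometric series.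
    The value [f] for [c = 0] follows the convention that inversion fixes nonunits. *)
Definition fps_inv f : fps K :=
  if f 0%N == 0 then f
  else fpsC (f 0%N)^-1 * fps_geom (1 - fpsC (f 0%N)^-1 * f).

Lemma fps_mulV f : f 0%N != 0 -> fps_inv f * f = 1.
Proof.
move=> f0; rewrite /fps_inv (negbTE f0).
set g := 1 - _; have g0 : g 0%N = 0 by rewrite /g fpsB fpsCM fps1 mulVf ?subrr.
have -> : fpsC (f 0%N)^-1 * fps_geom g * f = (1 - g) * fps_geom g.
  by rewrite /g opprB addrCA subrr addr0 mulrAC.
exact: fps_geomP.
Qed.

Let fps_mulVx : {in [pred f : fps K | f 0%N != 0], left_inverse 1 fps_inv *%R}.
Proof. by move=> f; exact: fps_mulV. Qed.

Let fps_unitPl f g : g * f = 1 -> f 0%N != 0.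
Proof.
move=> gf; apply/eqP => f0; have : (g * f) 0%N = 1 by rewrite gf.
by rewrite fpsM big_ord1 f0 mulr0 => /esym/eqP; rewrite oner_eq0.
Qed.

Let fps_inv_out : {in [predC [pred f : fps K | f 0%N != 0]], fps_inv =1 id}.
Proof. by move=> f; rewrite !inE negbK /fps_inv => ->. Qed.

HB.instance Definition _ := GRing.ComNzRing_hasMulInverse.Build (fps K)
  fps_mulVx fps_unitPl fps_inv_out.

Lemma fps_integral : GRing.integral_domain_axiom (fps K).
Proof.
move=> f g fg0; apply/norP => -[/eqP/ord_ex[m [fm fm']] /eqP/ord_ex[n [gn gn']]].
have := fpsM_lead fm' gn'; rewrite fg0 => /esym/eqP.
by rewrite mulf_eq0 (negbTE fm) (negbTE gn).
Qed.

HB.instance Definition _ := GRing.ComUnitRing_isIntegral.Build (fps K)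
  fps_integral.

(** Since [f = t^m u] with [u] a unit, [w] is [u^-1] times [g] shifted down by [m]. *)
Lemma ord_ge_div m n f g : f m != 0 -> ord_ge m f -> ord_ge (m + n) g ->
  exists2 w, ord_ge n w & g = w * f.
Proof.
move=> fm fge ginm; pose u : fps K := fun k => f (m + k)%N.
have u0 : u 0%N != 0 by rewrite /u addn0.
have gm : ord_ge m g by apply: ord_ge_le ginm; rewrite leq_addr.
exists (fps_inv u * (fun k => g (m + k)%N)).
  by apply: (@ord_geM 0) => // i iN; apply: ginm; rewrite ltn_add2l.
rewrite [f in RHS](ord_ge_factor fge) -/u mulrCA [_ * u]mulrAC fps_mulV // mul1r.
exact: ord_ge_factor.
Qed.

End PowerSeries.

(** * Ideals and Baer's criterion *)

Section IdealTheory.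
Variable R : comNzRingType.
Implicit Types I J : set R.

Lemma idealM I a x : ideal I -> I x -> I (a * x).
Proof. by move=> [I0 Ilin] Ix; rewrite -[a * x]addr0; apply: Ilin. Qed.

Lemma idealD I x y : ideal I -> I x -> I y -> I (x + y).
Proof. by move=> [_ Ilin] Ix Iy; rewrite -[x]mul1r; apply: Ilin. Qed.

Lemma idealB I x y : ideal I -> I x -> I y -> I (x - y).
Proof.
by move=> Iid Ix Iy; rewrite -mulN1r; apply: idealD => //; apply: idealM.
Qed.

Lemma ideal_sum I (T : Type) (r : seq T) (F : T -> R) :
  ideal I -> (forall i, I (F i)) -> I (\sum_(i <- r) F i).
Proof.
move=> Iid IF; elim: r => [|i r IH]; first by rewrite big_nil; case: Iid.
by rewrite big_cons; apply: idealD.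
Qed.

Lemma ideal_setT I : ideal I -> I 1 -> I = setT.
Proof.
move=> Iid I1; apply/seteqP; split=> // x _.
by rewrite -[x]mulr1; apply: idealM.
Qed.

Lemma sub_ideal_gen (A : set R) : A `<=` ideal_gen A.
Proof.
move=> x Ax; exists 1%N, (fun=> 1), (fun=> x); split=> //.
by rewrite big_ord1 mul1r.
Qed.

Lemma ideal_gen_ideal (A : set R) : ideal (ideal_gen A).
Proof.
split.
  by exists 0%N, (fun=> 0), (fun=> 0); rewrite big_ord0; split=> // -[].
move=> a _ _ [m [b [g [Ag ->]]]] [n [c [h [Ah ->]]]].
exists (m + n)%N,
  (fun i => match fintype.split i with inl j => a * b j | inr j => c j end),
  (fun i => match fintype.split i with inl j => g j | inr j => h j end).
split; first by move=> i; case: fintype.split.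
rewrite big_split_ord mulr_sumr /=; congr (_ + _); apply: eq_bigr => i _.
  by rewrite (unsplitK (inl i : 'I_m + 'I_n)) mulrA.
by rewrite (unsplitK (inr i : 'I_m + 'I_n)).
Qed.

Lemma ideal_gen_min (A I : set R) : ideal I -> A `<=` I -> ideal_gen A `<=` I.
Proof.
move=> Iid AI _ [n [a [g [Ag ->]]]].
by apply: ideal_sum => // i; apply: idealM => //; apply: AI.
Qed.

Lemma ideal_pow_ideal I n : ideal (ideal_pow I n).
Proof. exact: ideal_gen_ideal. Qed.

Lemma ideal_pow0 I x : ideal_pow I 0 x.
Proof.
rewrite -[x]mulr1; apply: idealM; first exact: ideal_pow_ideal.
by apply: sub_ideal_gen; exists (fun=> 0); split=> [[]|]//; rewrite big_ord0.
Qed.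

Lemma ideal_powS I n x y : I x -> ideal_pow I n y -> ideal_pow I n.+1 (x * y).
Proof.
move=> Ix [k [a [g [gI ->]]]]; rewrite mulr_sumr.
apply: ideal_sum; first exact: ideal_pow_ideal.
move=> i; rewrite mulrCA; apply: idealM; first exact: ideal_pow_ideal.
have [h [hI ->]] := gI i; apply: sub_ideal_gen.
(* Index [0] gets the new factor [x]; the other indices are those of [h]. *)
exists (fun j => oapp h x (unlift ord0 j)); split.
  by move=> j; case: unliftP => [j' _|_] //=.
rewrite big_ord_recl unlift_none; congr (_ * _).
by apply: eq_bigr => j _; rewrite liftK.
Qed.

Lemma ideal_pow_min I J n : ideal J ->
  (forall g : 'I_n -> R, (forall i, I (g i)) -> J (\prod_(i < n) g i)) ->
  ideal_pow I n `<=` J.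
Proof. by move=> Jid IJ; apply: ideal_gen_min => // _ [g [gI ->]]; apply: IJ. Qed.

Lemma quotient_length_setT : quotient_length (setT : set R) 0.
Proof. by exists (fun=> setT); split. Qed.

Lemma quotient_length_cons I J l : ideal I -> I `<` J ->
  (forall L, ideal L -> I `<=` L -> L `<=` J -> L = I \/ L = J) ->
  quotient_length J l -> quotient_length I l.+1.
Proof.
move=> Iid IJ simp [C [C0 Cl Cid Cstep]].
exists (fun k => if k is k'.+1 then C k' else I); split=> //.
  by case=> [|k] //; rewrite ltnS => /Cid.
case=> [|k]; first by rewrite C0.
by rewrite ltnS => /Cstep.
Qed.

End IdealTheory.

(** * Baer's criterion *)

Section Baer.
Variables (R : comNzRingType) (E : lmodType R).

(** Ideals are predicates on [R], so a linear map from [I] to [E] is represented by a total function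
    that is linear on [I]. *)
Definition baer_condition : Prop :=
  forall (I : set R) (f : R -> E), ideal I ->
    (forall a x y, I x -> I y -> f (a * x + y) = a *: f x + f y) ->
    exists e, forall x, I x -> f x = x *: e.

(* Zorn's lemma is applied to the graphs of the partial extensions. *)
Theorem baer_criterion : baer_condition -> injective_module E.
Proof.
move=> baer M N i f inji.
pose lin (G : set (N * E)) := G (0, 0) /\
  forall a x y u v, G (x, u) -> G (y, v) -> G (a *: x + y, a *: u + v).
pose ext (G : set (N * E)) := [/\ forall m, G (i m, f m), lin G &
  forall v, G (0, v) -> v = 0].
pose base : set (N * E) := [set p | exists m, p = (i m, f m)].
have extb : ext base.
  split; first by move=> m; exists m.
    split; first by exists 0; rewrite !linear0.
    move=> a x y u v [m [-> ->]] [n [-> ->]]; exists (a *: m + n).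
    by rewrite !linearP.
  move=> v [m [im ->]]; have -> : m = 0 by apply: inji; rewrite linear0.
  by rewrite linear0.
have [|A [PA maxA]] := @Zorn_bigcup _ [set G | G = set0 \/ ext G].
  move=> F FP Ftot.
  have [[G0 FG0 extG0]|noext] := pselect (exists2 G, F G & ext G); last first.
    left; apply/seteqP; split=> // x [G FG Gx].
    have [G0|extG] := FP _ FG; first by rewrite G0 in Gx.
    by case: noext; exists G.
  right; have extF G p : F G -> G p -> ext G.
    by move=> FG Gp; have [G0'|//] := FP _ FG; rewrite G0' in Gp.
  have [bG0 [linG00 linG0] zG0] := extG0.
  split.
  - by move=> m; exists G0.
  - split; first by exists G0.
    move=> a x y u v [G FG Gx] [G' FG' Gy].
    have [_ [_ lG] _] := extF _ _ FG Gx; have [_ [_ lG'] _] := extF _ _ FG' Gy.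
    have [sub|sub] := Ftot _ _ FG FG'.
      by exists G' => //; apply: lG' => //; apply: sub.
    by exists G => //; apply: lG => //; apply: sub.
  - by move=> v [G FG Gv]; have [_ _ ] := extF _ _ FG Gv; apply.
have extA : ext A.
  case: PA => // A0; case: (maxA base); last by right.
  rewrite A0; split=> // b0.
  by suff : (set0 : set (N * E)) (i 0, f 0) by []; apply: b0; exists 0.
have [bA [A0 linA] zA] := extA.
have AB x y u v : A (x, u) -> A (y, v) -> A (x - y, u - v).
  move=> Ax Ay; have := linA (-1) _ _ _ _ Ay Ax.
  by rewrite !scaleN1r ![- _ + _]addrC.
have AZ a x u : A (x, u) -> A (a *: x, a *: u).
  by move=> Ax; have := linA a _ _ _ _ Ax A0; rewrite !addr0.
have Auniq x u v : A (x, u) -> A (x, v) -> u = v.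
  move=> Au Av; apply/eqP; rewrite -subr_eq0; apply/eqP/zA.
  by rewrite -(subrr x); apply: AB.
have Atot n : exists e, A (n, e).
  (* If [n] is outside the domain of [A], the scalars [r] with [r n] in the domain form an ideal
     [I], and the value of [A] at [r n] is linear in [r]. Baer's condition yields [e0], and sending
     [n] to [e0] enlarges [A]. *)
  apply: contrapT => nA.
  pose I : set R := [set r | exists e, A (r *: n, e)].
  have [fI fIP] : exists fI : R -> E, forall r, I r -> A (r *: n, fI r).
    exists (fun r => xget 0 [set e | A (r *: n, e)]) => r [e Ae].
    by case: xgetP => [e' _ //|/(_ e)].
  have Iid : ideal I.
    split; first by exists 0; rewrite scale0r.
    move=> a x y [u Ax] [v Ay]; exists (a *: u + v).
    by rewrite scalerDl -scalerA; apply: linA.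
  have [a x y Ix Iy|e0 e0P] := baer I fI Iid.
    apply: (Auniq ((a * x + y) *: n)); first by apply: fIP; apply Iid.2.
    by rewrite scalerDl -scalerA; apply: linA; apply: fIP.
  pose B : set (N * E) := [set p | exists x u r,
    A (x, u) /\ p = (x + r *: n, u + r *: e0)].
  apply: (maxA B).
    split.
      by case=> x u Ax; exists x, u, 0; rewrite !scale0r !addr0.
    move=> BA; apply: nA; exists e0; apply: BA; exists 0, 0, 1.
    by rewrite !scale1r !add0r.
  right; split.
  - by move=> m; exists (i m), (f m), 0; rewrite !scale0r !addr0.
  - split; first by exists 0, 0, 0; rewrite !scale0r !addr0.
    move=> a _ _ _ _ [x [u [r [Ax [-> ->]]]]] [y [v [s [Ay [-> ->]]]]].
    exists (a *: x + y), (a *: u + v), (a * r + s).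
    split; first exact: linA.
    by rewrite !scalerDr !scalerDl !scalerA; congr (_, _); exact: addrACA.
  (* If [x + r n = 0], then [A] takes the value [- u] at [r n]; since [r] is in [I], this value is
     [r e0]. *)
  - move=> _ [x [u [r [Ax [xr ->]]]]].
    have Ar : A (r *: n, - u).
      have -> : r *: n = - x by apply/eqP; rewrite -addr_eq0 addrC -xr.
      by have := AB _ _ _ _ A0 Ax; rewrite !sub0r.
    have Ir : I r by exists (- u).
    by rewrite -e0P // (Auniq _ _ _ (fIP _ Ir) Ar) subrr.
have /choice[g gP] := Atot.
have glin : linear g.
  move=> a x y; apply: (Auniq (a *: x + y)) => //; exact: linA.
pose gL := GRing.isLinear.Build R N E *:%R g glin.
pose g' : {linear N -> E} := HB.pack g gL.
by exists g' => m /=; apply: (Auniq (i m)).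
Qed.

End Baer.

(** * Complete semigroup rings *)

Section SemigroupRingTheory.
Variables (K : fieldType) (H : numerical_semigroup).
Local Notation R := (semigroup_ring K H).
Implicit Types (x y : R) (f : fps K) (I : set R).

Lemma sr_fpsB x y : sr_fps (x - y) = sr_fps x - sr_fps y.
Proof. exact: (rmorphB (val : R -> fps K)). Qed.

Lemma sr_fpsD x y : sr_fps (x + y) = sr_fps x + sr_fps y.
Proof. exact: (rmorphD (val : R -> fps K)). Qed.

Lemma sr_fpsM x y : sr_fps (x * y) = sr_fps x * sr_fps y.
Proof. exact: (rmorphM (val : R -> fps K)). Qed.

Lemma sr_fps1 : sr_fps (1 : R) = 1.
Proof. exact: (rmorph1 (val : R -> fps K)). Qed.

Lemma sr_fps0 : sr_fps (0 : R) = 0.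
Proof. exact: (rmorph0 (val : R -> fps K)). Qed.

Lemma sr_fpsX x n : sr_fps (x ^+ n) = sr_fps x ^+ n.
Proof. exact: (rmorphXn (val : R -> fps K)). Qed.

Lemma sr_fps_sum (T : Type) (r : seq T) (F : T -> R) :
  sr_fps (\sum_(i <- r) F i) = \sum_(i <- r) sr_fps (F i).
Proof. exact: (rmorph_sum (val : R -> fps K)). Qed.

Lemma sr_fps_inj : injective (@sr_fps K H).
Proof. exact: val_inj. Qed.

Lemma sr_fps_out x n : ~ H n -> sr_fps x n = 0.
Proof. by move: n; exact/asboolP/sr_supported. Qed.

Definition to_sr f : R := insubd 0 f.

Lemma to_srK f : (forall n, ~ H n -> f n = 0) -> sr_fps (to_sr f) = f.
Proof. by move=> fH; rewrite [LHS]insubdK //; apply/asboolP. Qed.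

(** For [k] outside [H] this is [0], the default value of [to_sr]. *)
Definition srX k : R := to_sr (fpsX K k).
Definition srC c : R := to_sr (fpsC c).

Lemma srXE k : H k -> sr_fps (srX k) = fpsX K k.
Proof.
by move=> Hk; rewrite to_srK // => n; rewrite /fpsX; case: eqP => // ->.
Qed.

Lemma srCE c : sr_fps (srC c) = fpsC c.
Proof.
rewrite to_srK // => n; rewrite /fpsC; case: eqP => // -> []; exact: ns_mem0.
Qed.

Lemma srCM c x n : sr_fps (srC c * x) n = c * sr_fps x n.
Proof. by rewrite sr_fpsM srCE fpsCM. Qed.

Lemma srXD a b : H a -> H b -> srX (a + b) = srX a * srX b.
Proof.
move=> Ha Hb; apply: sr_fps_inj.
by rewrite sr_fpsM !srXE ?fpsXD //; exact: ns_memD.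
Qed.

Lemma sr_fpsCX c k n : H k -> sr_fps (srC c * srX k) n = c * (n == k)%:R.
Proof. by move=> Hk; rewrite srCM srXE. Qed.

(** The inverse in [K[[t]]] has its support in [H]: each coefficient of the geometric series is a
    coefficient of a finite sum of powers, which lies in the subring. *)
Lemma sr_unit x : sr_fps x 0%N != 0 -> exists y, y * x = 1.
Proof.
move=> x0; have sup : fps_inv (sr_fps x) \in supported H.
  have supC (c : K) : fpsC c \in supported H by rewrite -srCE; apply: sr_supported.
  rewrite /fps_inv (negbTE x0) rpredM //.
  apply/asboolP => n nH; rewrite /fps_geom.
  have : (\sum_(k < n.+1) (1 - fpsC (sr_fps x 0%N)^-1 * sr_fps x) ^+ k)
     \in supported H.
    apply: rpred_sum => k _; apply: rpredX; apply: rpredB; first exact: rpred1.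
    by apply: rpredM => //; apply: sr_supported.
  by move/asboolP; apply.
exists (SemigroupRing sup); apply: sr_fps_inj.
by rewrite sr_fpsM sr_fps1 fps_mulV.
Qed.

(** * The order filtration and the maximal ideal *)

Definition sr_ord_ge n : set R := [set x | ord_ge n (sr_fps x)].

Lemma sr_ord_geE n x : sr_ord_ge n x = ord_ge n (sr_fps x).
Proof. by []. Qed.

Lemma sr_ord_ge_ideal n : ideal (sr_ord_ge n).
Proof.
split=> [i _|a x y xn yn]; first by rewrite sr_fps0.
rewrite sr_ord_geE sr_fpsD sr_fpsM; apply: ord_geD => //.
exact: (@ord_geM _ 0).
Qed.

Definition sr_max : set R := sr_ord_ge 1.

Lemma sr_maxE x : sr_max x <-> sr_fps x 0%N = 0.
Proof. by split=> [|x0 [|//]]; first exact. Qed.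

Lemma sr_max_proper : ~ sr_max 1.
Proof.
by move=> /sr_maxE; rewrite sr_fps1 => /eqP; rewrite fps1 oner_eq0.
Qed.

Lemma sr_max_contains I : ideal I -> ~ I 1 -> I `<=` sr_max.
Proof.
move=> Iid I1 x Ix; apply/sr_maxE/eqP/negPn/negP => /sr_unit[y yx].
by apply: I1; rewrite -yx; apply: idealM.
Qed.

Lemma sr_max_maximal : maximal_ideal sr_max.
Proof.
split; [exact: sr_ord_ge_ideal | exact: sr_max_proper | move=> J Jid [mJ Jm]].
apply: ideal_setT => //; apply: contrapT => J1; apply: Jm.
exact: sr_max_contains.
Qed.

Lemma sr_local : local_ring_with sr_max.
Proof.
split; first exact: sr_max_maximal.
move=> m' [idm' m'1 maxm']; apply: contrapT => neq.
have sub := sr_max_contains idm' m'1.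
have strict : m' `<` sr_max.
  by split=> // sub'; apply: neq; apply/seteqP; split.
by apply: sr_max_proper; rewrite (maxm' sr_max (sr_ord_ge_ideal 1) strict).
Qed.

Lemma sr_ord_ex x : x <> 0 -> exists v, sr_fps x v != 0 /\ sr_ord_ge v x.
Proof.
by move=> x0; apply: ord_ex => e; apply: x0; apply: sr_fps_inj; rewrite sr_fps0.
Qed.

Lemma sr_mulf_eq0 x y : x * y = 0 -> x = 0 \/ y = 0.
Proof.
move=> xy; have /eqP : sr_fps x * sr_fps y = 0 by rewrite -sr_fpsM xy sr_fps0.
by rewrite mulf_eq0 => /orP[]/eqP e; [left|right]; apply: sr_fps_inj;
  rewrite sr_fps0.
Qed.

Lemma sr_ord_ge_elim n x y : sr_fps y n != 0 -> sr_ord_ge n x ->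
  sr_ord_ge n y -> sr_ord_ge n.+1 (x - srC (sr_fps x n / sr_fps y n) * y).
Proof.
move=> yn xge yge k; rewrite ltnS leq_eqVlt sr_fpsB fpsB srCM.
case/orP => [/eqP ->|kn]; first by rewrite divfK ?subrr.
by rewrite (xge k kn) (yge k kn) mulr0 subrr.
Qed.

Lemma sr_ord_geS n x : sr_ord_ge n x -> sr_fps x n = 0 -> sr_ord_ge n.+1 x.
Proof.
move=> xn x0 k; rewrite ltnS leq_eqVlt => /orP[/eqP -> //|]; exact: xn.
Qed.

(** Descending induction on [n] from [L]: for [n] in [H], subtracting a multiple of [t^n] raises the
    order; at a gap the coefficient is already zero. *)
Lemma ideal_of_monomials I L n : ideal I -> sr_ord_ge L `<=` I ->
  (forall k, (n <= k)%N -> H k -> I (srX k)) -> sr_ord_ge n `<=` I.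
Proof.
move=> Iid IL; move: {2}(L - n)%N (erefl (L - n)%N) => d.
elim: d n => [|d IH] n dE IX x xn.
  by apply: IL; apply: ord_ge_le xn; rewrite -subn_eq0 dE.
have IS : sr_ord_ge n.+1 `<=` I.
  by apply: IH => [|k nk]; [rewrite subnS dE|apply: IX; apply: ltnW].
have [Hn|nH] := pselect (H n); last first.
  by apply: IS; apply: sr_ord_geS => //; exact: sr_fps_out.
have Xn : sr_fps (srX n) n = 1 by rewrite srXE // /fpsX eqxx.
have /IS : sr_ord_ge n.+1 (x - srC (sr_fps x n / sr_fps (srX n) n) * srX n).
  apply: sr_ord_ge_elim => //; first by rewrite Xn oner_eq0.
  by rewrite sr_ord_geE srXE //; exact: ord_geX.
move=> Ix; rewrite -[x](subrK (srC (sr_fps x n / sr_fps (srX n) n) * srX n)).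
by apply: idealD => //; apply: idealM => //; apply: IX.
Qed.

(** The filtration by order jumps exactly at the elements of [H]. Each jump is simple, since an
    element with nonzero coefficient at [t^N] can cancel that coefficient in any other. *)
Lemma quotient_length_sr_ord_ge N :
  quotient_length (sr_ord_ge N) (\sum_(i < N) `[< H i >]).
Proof.
elim: N => [|N IH].
  rewrite big_ord0; have -> : sr_ord_ge 0 = setT by apply/seteqP; split.
  exact: quotient_length_setT.
rewrite big_ord_recr /=; case: asboolP => [HN|nH]; last first.
  rewrite addn0; have -> // : sr_ord_ge N.+1 = sr_ord_ge N.
  apply/seteqP; split=> x; first exact: ord_ge_le.
  by move/sr_ord_geS; apply; exact: sr_fps_out.
rewrite addn1; apply: quotient_length_cons IH; first exact: sr_ord_ge_ideal.
  split=> [x|]; first exact: ord_ge_le.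
  move/(_ (srX N)); rewrite !sr_ord_geE srXE // => /(_ (@ord_geX _ _)).
  by move/(_ N (ltnSn N))/eqP; rewrite /fpsX eqxx oner_eq0.
move=> J Jid subJ Jsub.
have [[y Jy yN]|allN] := pselect (exists2 y, J y & sr_fps y N != 0); last first.
  left; apply/seteqP; split=> // x Jx; apply: sr_ord_geS; first exact: Jsub.
  by apply/eqP/negPn/negP => xN; apply: allN; exists x.
right; apply/seteqP; split=> // x xN.
rewrite -[x](subrK (srC (sr_fps x N / sr_fps y N) * y)).
apply: idealD => //; last exact: idealM.
by apply: subJ; apply: sr_ord_ge_elim => //; apply: Jsub.
Qed.

(** * Finite complement: noetherianity and dimension one *)

Variable c : nat.
Hypothesis conductor : forall n, (c <= n)%N -> H n.

Lemma to_sr_ord_ge f : ord_ge c f -> sr_fps (to_sr f) = f.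
Proof.
move=> fc; apply: to_srK => n nH; apply: fc.
by rewrite ltnNge; apply/negP => /conductor.
Qed.

(** The quotient in [K[[t]]] has order at least [n >= c], which forces its support into [H]. *)
Lemma sr_ord_ge_div v n x y : sr_fps x v != 0 -> sr_ord_ge v x -> (c <= n)%N ->
  sr_ord_ge (v + n) y -> exists2 w, sr_ord_ge n w & y = w * x.
Proof.
move=> xv xge cn yge; have [w wn yE] := ord_ge_div xv xge yge.
have wE : sr_fps (to_sr w) = w by apply: to_sr_ord_ge; apply: ord_ge_le wn.
exists (to_sr w); first by rewrite sr_ord_geE wE.
by apply: sr_fps_inj; rewrite sr_fpsM wE.
Qed.

Lemma ideal_open I x : ideal I -> I x -> x <> 0 -> exists L, sr_ord_ge L `<=` I.
Proof.
move=> Iid Ix /sr_ord_ex[v [xv xge]]; exists (v + c)%N => y yge.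
by have [w _ ->] := sr_ord_ge_div xv xge (leqnn c) yge; apply: idealM.
Qed.

(** A nonzero [x] in [I] of order [v] generates everything of order at least [v + c]. Each smaller
    order contributes at most one further generator, an element of [I] of exactly that order. *)
Lemma sr_noetherian : noetherian R.
Proof.
move=> I Iid.
suff [s [sI Is]] : exists s : seq R, {in s, forall x, I x} /\
    I `<=` ideal_gen [set x | x \in s].
  exists s; apply/seteqP; split=> //.
  by apply: ideal_gen_min => // x /sI.
have [[x Ix x0]|I0] := pselect (exists2 x, I x & x <> 0); last first.
  exists [::]; split=> // x Ix; have -> : x = 0.
    by apply: contrapT => x0; apply: I0; exists x.
  by case: (ideal_gen_ideal [set x : R | x \in [::]]).
have [v [xv xge]] := sr_ord_ex x0.
suff gens d : exists s : seq R, {in s, forall x, I x} /\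
    forall y, I y -> sr_ord_ge (v + c - d) y -> ideal_gen [set x | x \in s] y.
  have [s [sI sP]] := gens (v + c)%N; exists s; split=> // y Iy.
  by apply: sP => //; rewrite subnn.
have mono (s : seq R) z : ideal_gen [set x | x \in s] `<=`
    ideal_gen [set x | x \in z :: s].
  apply: ideal_gen_min; first exact: ideal_gen_ideal.
  by move=> u us; apply: sub_ideal_gen; rewrite /= inE us orbT.
elim: d => [|d [s [sI sP]]].
  exists [:: x]; split=> [y|y Iy yge]; first by rewrite inE => /eqP ->.
  rewrite subn0 in yge; have [w _ ->] := sr_ord_ge_div xv xge (leqnn c) yge.
  apply: idealM; first exact: ideal_gen_ideal.
  by apply: sub_ideal_gen; rewrite /= inE.
have [le|lt] := leqP (v + c) d.
  exists s; split=> // y Iy _; apply: sP => //.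
  by rewrite (eqP le).
set n := (v + c - d.+1)%N; have nS : (v + c - d)%N = n.+1.
  by rewrite /n -subSn.
rewrite nS in sP.
have [[z [Iz zn zge]]|noz] :=
    pselect (exists z, [/\ I z, sr_fps z n != 0 & sr_ord_ge n z]); last first.
  exists s; split=> // y Iy yge; apply: sP => //; apply: sr_ord_geS => //.
  by apply/eqP/negPn/negP => yn; apply: noz; exists y.
exists (z :: s); split=> [y|y Iy yge].
  by rewrite inE => /orP[/eqP ->|/sI].
rewrite -[y](subrK (srC (sr_fps y n / sr_fps z n) * z)).
apply: idealD; first exact: ideal_gen_ideal.
  apply/mono/sP; last exact: sr_ord_ge_elim.
  by apply: idealB => //; apply: idealM.
apply: idealM; first exact: ideal_gen_ideal.
by apply: sub_ideal_gen; rewrite /= inE eqxx.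
Qed.

(** A nonzero ideal contains all series of large order, hence a power of each element of the maximal
    ideal; primality then gives the element itself. *)
Lemma sr_prime_max P x : prime_ideal P -> P x -> x <> 0 -> P = sr_max.
Proof.
move=> [Pid P1 Pprime] Px x0; apply/seteqP; split.
  exact: sr_max_contains.
move=> y /sr_maxE y0; have [L PL] := ideal_open Pid Px x0.
have : P (y ^+ L) by apply: PL; rewrite sr_ord_geE sr_fpsX; apply: ord_ge_exp.
elim: L {PL} => [|L IH]; first by rewrite expr0.
by rewrite exprS => /Pprime[].
Qed.

Lemma sr_krull_dim : krull_dim R 1.
Proof.
have zero_prime : prime_ideal [set 0 : R].
  split; last exact: sr_mulf_eq0.
    by split=> // a x y -> ->; rewrite mulr0 addr0.
  by move/eqP; rewrite oner_eq0.
have max_prime : prime_ideal sr_max.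
  split; [exact: sr_ord_ge_ideal | exact: sr_max_proper |].
  move=> x y /sr_maxE; rewrite sr_fpsM fpsM big_ord1 => /eqP.
  by rewrite mulf_eq0 => /orP[]/eqP ?; [left|right]; apply/sr_maxE.
split.
  exists (fun i => if i is 0 then [set 0] else sr_max); split.
    by case=> [|i].
  case=> // _; split=> [x ->|sub]; first exact: (sr_ord_ge_ideal 1).1.
  have Hc : H c.+1 by apply: conductor.
  have : [set 0 : R] (srX c.+1).
    by apply: sub; rewrite /sr_max sr_ord_geE srXE //;
      apply: ord_ge_le (@ord_geX _ _).
  move/(congr1 (fun x : R => sr_fps x c.+1))/eqP.
  by rewrite sr_fps0 srXE // /fpsX eqxx oner_eq0.
move=> n C [Cprime Cstep]; rewrite leqNgt; apply/negP => n1.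
(* Each term after the first strictly contains its predecessor, hence has a nonzero element. *)
have nonzero i : (0 < i <= n)%N -> C i = sr_max.
  case: i => // i /= lin; have [sub nsub] := Cstep i lin.
  have [x Cx x0] : exists2 x, C i.+1 x & x <> 0.
    apply: contrapT => nx; apply: nsub => x Cx; apply: contrapT => Cix.
    apply: nx; exists x => // x0; apply: Cix; rewrite x0.
    by have [[]] := Cprime i (ltnW lin).
  exact: sr_prime_max (Cprime i.+1 lin) Cx x0.
have [_ nsub] := Cstep 1%N n1; apply: nsub.
by rewrite (nonzero 2%N) // (nonzero 1%N) ?(ltnW n1).
Qed.

End SemigroupRingTheory.

(** * The continuous dual *)

Section FractionNumden.
Import generic_quotient.
Local Open Scope quotient_scope.

Lemma fraction_numden (D : idomainType) (q : {fraction D}) :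
  exists a b : D, b != 0 /\ tofrac b * q = tofrac a.
Proof.
elim/quotW: q => x; exists (\n_x), (\d_x); split; first exact: denom_ratioP.
unlock FracField.tofrac; rewrite -[LHS]FracField.pi_mul; apply/eqmodP.
rewrite /= FracField.equivfE /FracField.mulf.
by rewrite !numden_Ratio ?(oner_neq0, mulf_neq0, denom_ratioP) //
   !mul1r mulr1 mulrC.
Qed.

End FractionNumden.

(** * Continuous functionals as a module *)

Section ContinuousDual.
Variables (K : fieldType) (H : numerical_semigroup).
Local Notation R := (semigroup_ring K H).

(** Continuity is meant for the topology of the order filtration on the ring and the discrete
    topology on [K]. *)
Definition continuous_functional : {pred (R -> K)} := fun phi =>
  `[< [/\ forall x y, phi (x + y) = phi x + phi y,
      forall c x, phi (srC H c * x) = c * phi x &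
      exists N, forall x, sr_ord_ge N x -> phi x = 0] >].

Lemma continuous_functional_zmod : zmod_closed continuous_functional.
Proof.
split.
  by apply/asboolP; split=> [x y|c x|]; rewrite ?addr0 ?mulr0 //; exists 0%N.
move=> phi psi /asboolP[phiD phiZ [N phi0]] /asboolP[psiD psiZ [M psi0]].
have subE x : (phi - psi) x = phi x - psi x by [].
apply/asboolP; split=> [x y|c x|].
- by rewrite !subE phiD psiD opprD addrACA.
- by rewrite !subE phiZ psiZ mulrBr.
- exists (maxn N M) => x xge; rewrite subE phi0 ?psi0 ?subrr //.
    exact: ord_ge_le (leq_maxr N M) xge.
  exact: ord_ge_le (leq_maxl N M) xge.
Qed.

HB.instance Definition _ := GRing.isZmodClosed.Build (R -> K)
  continuous_functional continuous_functional_zmod.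

Record sr_dual := SrDual {
  sr_dual_fun :> R -> K;
  sr_dual_cont : sr_dual_fun \in continuous_functional }.

HB.instance Definition _ := [isSub for sr_dual_fun].
HB.instance Definition _ := [Choice of sr_dual by <:].
HB.instance Definition _ := [SubChoice_isSubZmodule of sr_dual by <:].

Lemma sr_dualD (phi psi : sr_dual) x : (phi + psi) x = phi x + psi x.
Proof. by []. Qed.

Lemma sr_dualP (phi psi : sr_dual) : (forall x, phi x = psi x) -> phi = psi.
Proof. by move=> eq; apply: val_inj; apply/funext. Qed.

Lemma sr_dual_linD (phi : sr_dual) x y : phi (x + y) = phi x + phi y.
Proof. by have /asboolP[] := sr_dual_cont phi. Qed.

Lemma sr_dual_linZ (phi : sr_dual) c x : phi (srC H c * x) = c * phi x.
Proof. by have /asboolP[] := sr_dual_cont phi. Qed.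

Lemma sr_dual_bound (phi : sr_dual) :
  exists N, forall x, sr_ord_ge N x -> phi x = 0.
Proof. by have /asboolP[] := sr_dual_cont phi. Qed.

Lemma sr_dual_scale_subproof (a : R) (phi : sr_dual) :
  (fun x => phi (a * x)) \in continuous_functional.
Proof.
apply/asboolP; split=> [x y|c x|].
- by rewrite mulrDr sr_dual_linD.
- by rewrite mulrCA sr_dual_linZ.
- have [N phi0] := sr_dual_bound phi; exists N => x xge; apply: phi0.
  exact: (@idealM _ _ a x (sr_ord_ge_ideal K H N) xge).
Qed.

Definition sr_dual_scale a phi := SrDual (sr_dual_scale_subproof a phi).

Lemma sr_dual_scaleA a b phi :
  sr_dual_scale a (sr_dual_scale b phi) = sr_dual_scale (a * b) phi.
Proof. by apply: sr_dualP => x /=; rewrite mulrCA mulrA. Qed.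

Lemma sr_dual_scale1 : left_id 1 sr_dual_scale.
Proof. by move=> phi; apply: sr_dualP => x /=; rewrite mul1r. Qed.

Lemma sr_dual_scaleDr : right_distributive sr_dual_scale +%R.
Proof. by move=> a phi psi; apply: sr_dualP. Qed.

Lemma sr_dual_scaleDl phi : {morph sr_dual_scale^~ phi : a b / a + b}.
Proof. by move=> a b; apply: sr_dualP => x /=; rewrite mulrDl sr_dual_linD. Qed.

HB.instance Definition _ := GRing.Zmodule_isLmodule.Build R sr_dual
  sr_dual_scaleA sr_dual_scale1 sr_dual_scaleDr sr_dual_scaleDl.

Lemma sr_dualZ a (phi : sr_dual) x : (a *: phi) x = phi (a * x).
Proof. by []. Qed.

Lemma sr_fps_monomial (x : R) i n :
  sr_fps (srC H (sr_fps x i) * srX K H i) n = sr_fps x i * (n == i)%:R.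
Proof.
have [Hi|nHi] := pselect (H i); first exact: sr_fpsCX.
by rewrite srCM sr_fps_out // !mul0r.
Qed.

(** The truncation [s] differs from [x] by an element of order at least [N], which [phi] kills. *)
Lemma sr_dual_expand (phi : sr_dual) N x :
  (forall x, sr_ord_ge N x -> phi x = 0) ->
  phi x = \sum_(i < N) sr_fps x i * phi (srX K H i).
Proof.
move=> phi0; pose s := \sum_(i < N) srC H (sr_fps x i) * srX K H i.
have phis : phi s = \sum_(i < N) sr_fps x i * phi (srX K H i).
  rewrite /s; have phi00 : phi 0 = 0.
    by apply: phi0; have [] := sr_ord_ge_ideal K H N.
  rewrite (big_morph phi (sr_dual_linD phi) phi00).
  by apply: eq_bigr => i _; rewrite sr_dual_linZ.
rewrite -[x](subrK s) sr_dual_linD subrK phis phi0 ?add0r // => n nN.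
rewrite sr_fpsB fpsB sr_fps_sum fps_sum.
rewrite (eq_bigr (fun i : 'I_N => sr_fps x i * (n == i)%:R)); last first.
  by move=> i _; exact: sr_fps_monomial.
rewrite (bigD1 (Ordinal nN)) //= eqxx mulr1 big1 ?addr0 ?subrr // => i /negbTE.
by rewrite -val_eqE /= eq_sym => ->; rewrite mulr0.
Qed.

Lemma sr_dual_coef_subproof N (b : nat -> K) :
  (fun x : R => \sum_(i < N) sr_fps x i * b i) \in continuous_functional.
Proof.
apply/asboolP; split=> [x y|c x|].
- rewrite -big_split; apply: eq_bigr => i _.
  by rewrite sr_fpsD fpsD; exact: mulrDl.
- by rewrite mulr_sumr; apply: eq_bigr => i _; rewrite srCM mulrA.
- by exists N => x xge; apply: big1 => i _; rewrite xge ?mul0r.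
Qed.

Definition sr_dual_coef N b := SrDual (sr_dual_coef_subproof N b).

(** * Injectivity of the continuous dual *)

Variable c : nat.
Hypothesis conductor : forall n, (c <= n)%N -> H n.

(** The coefficients [b] are chosen by descending order: if [I] has an element [z] of order exactly
    [n], then [b n] is adjusted to give the right value at [z], which leaves the values in higher
    order unchanged. *)
Lemma sr_dual_extend (I : set R) (lam : R -> K) L :
  ideal I ->
  (forall x y, I x -> I y -> lam (x + y) = lam x + lam y) ->
  (forall c x, I x -> lam (srC H c * x) = c * lam x) ->
  (forall x, I x -> sr_ord_ge L x -> lam x = 0) ->
  exists b, forall x, I x -> lam x = sr_dual_coef L b x.
Proof.
move=> Iid lamD lamZ lam0.
suff ext d : exists b, forall x, I x -> sr_ord_ge (L - d) x ->
    lam x = sr_dual_coef L b x.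
  by have [b bP] := ext L; exists b => x Ix; apply: bP => //; rewrite subnn.
elim: d => [|d [b bP]].
  exists (fun=> 0) => x Ix; rewrite subn0 => /lam0 -> //.
  by rewrite /= big1 // => i _; rewrite mulr0.
have [le|lt] := leqP L d.
  by exists b => x Ix _; apply: bP => //; rewrite (eqP le).
set n := (L - d.+1)%N; have nS : (L - d)%N = n.+1 by rewrite /n -subSn.
have nL : (n < L)%N by rewrite -nS leq_subr.
rewrite nS in bP.
have [[z [Iz zn zge]]|noz] :=
    pselect (exists z, [/\ I z, sr_fps z n != 0 & sr_ord_ge n z]); last first.
  exists b => x Ix xge; apply: bP => //; apply: sr_ord_geS => //.
  by apply/eqP/negPn/negP => xn; apply: noz; exists x.
pose b' i := if i == n then b n + (lam z - sr_dual_coef L b z) / sr_fps z n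
             else b i.
have b'E x : sr_dual_coef L b' x = sr_dual_coef L b x +
    sr_fps x n / sr_fps z n * (lam z - sr_dual_coef L b z).
  rewrite /= (bigD1 (Ordinal nL)) //= [in RHS](bigD1 (Ordinal nL)) //=.
  rewrite /b' eqxx mulrDr -!addrA; congr (_ + _); rewrite addrC; congr (_ + _).
    by apply: eq_bigr => i /negbTE; rewrite -val_eqE /= => ->.
  by rewrite mulrAC mulrA.
exists b' => x Ix xge; rewrite b'E.
set k := sr_fps x n / sr_fps z n; pose y := x - srC H k * z.
have Ikz : I (srC H k * z) by apply: idealM.
have yge : sr_ord_ge n.+1 y by apply: sr_ord_ge_elim.
have Iy : I y by apply: idealB.
rewrite -[x](subrK (srC H k * z)) -/y lamD // lamZ // bP //.
rewrite !sr_dual_linD sr_dual_linZ mulrBr addrACA -!addrA; congr (_ + _).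
by rewrite subrr addr0.
Qed.

(** Evaluation at [1] turns a linear map from [I] to the dual into a functional on [I]; an extension
    of that functional to the ring is the element that Baer's criterion asks for. *)
Lemma sr_dual_injective : injective_module (sr_dual : lmodType R).
Proof.
apply: baer_criterion => I f Iid flin.
have I0 : I 0 by case: Iid.
have f0 : f 0 = 0.
  have := flin 1 0 0 I0 I0; rewrite mulr0 addr0 scale1r => /eqP.
  by rewrite -{1}[f 0]addr0 (inj_eq (addrI _)) eq_sym => /eqP.
have fM a x : I x -> f (a * x) = a *: f x.
  by move=> Ix; have := flin a x 0 Ix I0; rewrite f0 !addr0.
have fD x y : I x -> I y -> f (x + y) = f x + f y.
  by move=> Ix Iy; have := flin 1 x y Ix Iy; rewrite mul1r scale1r.
have [[x0 Ix0 x0n]|nx0] := pselect (exists2 x, I x & x <> 0); last first.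
  exists 0 => x Ix; have -> : x = 0.
    by apply: contrapT => x0; apply: nx0; exists x.
  by rewrite f0 scaler0.
have [v [x0v x0ge]] := sr_ord_ex x0n.
have [N fx0N] := sr_dual_bound (f x0).
have [|||b bP] := @sr_dual_extend I (fun x => f x 1) (v + (c + N)) Iid.
- by move=> x y Ix Iy; rewrite fD // sr_dualD.
- by move=> k x Ix; rewrite fM // sr_dualZ sr_dual_linZ.
(* One nonzero [x0] in [I] gives continuity: a [y] of large order is [w x0] with [w] of order at
   least [N], and [f x0] kills [w]. *)
- move=> y Iy yge.
  have [w wge ->] := sr_ord_ge_div conductor x0v x0ge (leq_addr N c) yge.
  rewrite fM // sr_dualZ mulr1; apply: fx0N.
  by apply: ord_ge_le wge; exact: leq_addl.
exists (sr_dual_coef (v + (c + N)) b) => x Ix; apply: sr_dualP => r.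
by rewrite sr_dualZ mulrC -bP ?fM ?sr_dualZ ?mulr1 //; apply: idealM.
Qed.

End ContinuousDual.

(** * The fraction field and the Gorenstein property *)

(** [H] enters the type so that each semigroup ring gets its own module structure on [K((t))]. *)
Definition sr_frac (K : fieldType) (H : numerical_semigroup) : Type :=
  {fraction (fps K)}.

HB.instance Definition _ (K : fieldType) (H : numerical_semigroup) :=
  GRing.Zmodule.copy (sr_frac K H) {fraction (fps K)}.

Section Fractions.
Variables (K : fieldType) (H : numerical_semigroup).
Local Notation R := (semigroup_ring K H).
Local Notation Q := {fraction (fps K)}.
Implicit Types (q : Q) (f : fps K).

Definition sr_frac_scale (a : R) (q : sr_frac K H) : sr_frac K H :=
  tofrac (sr_fps a) * (q : Q).

Lemma sr_frac_scaleA a b q :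
  sr_frac_scale a (sr_frac_scale b q) = sr_frac_scale (a * b) q.
Proof. by rewrite /sr_frac_scale sr_fpsM tofracM mulrA. Qed.

Lemma sr_frac_scale1 : left_id 1 sr_frac_scale.
Proof. by move=> q; rewrite /sr_frac_scale sr_fps1 tofrac1 mul1r. Qed.

Lemma sr_frac_scaleDr : right_distributive sr_frac_scale +%R.
Proof. by move=> a p q; exact: mulrDr. Qed.

Lemma sr_frac_scaleDl q : {morph sr_frac_scale^~ q : a b / a + b}.
Proof.
by move=> a b; rewrite /sr_frac_scale sr_fpsD tofracD; exact: mulrDl.
Qed.

HB.instance Definition _ := GRing.Zmodule_isLmodule.Build R (sr_frac K H)
  sr_frac_scaleA sr_frac_scale1 sr_frac_scaleDr sr_frac_scaleDl.

Lemma sr_fracZ (a : R) (q : sr_frac K H) :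
  a *: q = tofrac (sr_fps a) * (q : Q).
Proof. by []. Qed.

Lemma tofrac_neq0 f : f <> 0 -> tofrac f != 0.
Proof. by move=> f0; rewrite tofrac_eq0; apply/eqP. Qed.

Lemma tofrac_inj : injective (@tofrac (fps K)).
Proof. by move=> f g /eqP; rewrite tofrac_eq => /eqP. Qed.

(** The fraction [f y / y] is the same for all nonzero [y] in [I], since
    [x f(y) = f(x y) = y f(x)]. *)
Lemma sr_frac_injective : injective_module (sr_frac K H : lmodType R).
Proof.
apply: baer_criterion => I f [I0 Ilin] flin.
have f0 : f 0 = 0.
  have := flin 1 0 0 I0 I0; rewrite mulr0 addr0 scale1r => /eqP.
  by rewrite -{1}[f 0]addr0 (inj_eq (addrI _)) eq_sym => /eqP.
have fM a x : I x -> f (a * x) = a *: f x.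
  by move=> Ix; have := flin a x 0 Ix I0; rewrite f0 !addr0.
have [[y Iy y0]|ny] := pselect (exists2 x, I x & x <> 0); last first.
  exists 0 => x Ix; have -> : x = 0.
    by apply: contrapT => x0; apply: ny; exists x.
  by rewrite f0 scaler0.
have yF : tofrac (sr_fps y) != 0.
  by apply: tofrac_neq0 => y0'; apply: y0; apply: sr_fps_inj; rewrite sr_fps0.
exists ((f y : Q) / tofrac (sr_fps y)) => x Ix.
apply: (mulfI yF); rewrite -[LHS]sr_fracZ -fM // mulrC fM // !sr_fracZ.
by rewrite mulrCA; congr (_ * _); rewrite mulrCA mulfV // mulr1.
Qed.

(* [q = t^(-v) f] *)
Definition laurent v f q := tofrac (fpsX K v) * q = tofrac f.

Lemma fpsX_neq0 v : fpsX K v <> 0.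
Proof.
move/(congr1 (fun f : fps K => f v))/eqP.
by rewrite /fpsX eqxx oner_eq0.
Qed.

(** A denominator of order [v] divides [t^v], so [t^v] can serve as denominator. *)
Lemma laurent_ex q : exists v f, laurent v f q.
Proof.
have [a [b [/eqP/ord_ex[v [bv bge]] bq]]] := fraction_numden q.
have [|w _ wE] := @ord_ge_div _ v 0 b (fpsX K v) bv bge.
  by rewrite addn0; exact: ord_geX.
by exists v, (w * a); rewrite /laurent wE !tofracM -mulrA bq.
Qed.

Lemma laurentM v f g q : laurent v f q -> laurent v (g * f) (tofrac g * q).
Proof. by rewrite /laurent tofracM => <-; rewrite mulrCA. Qed.

Lemma laurentX v w f q : laurent v f q -> laurent (w + v) (fpsX K w * f) q.
Proof. by rewrite /laurent fpsXD !tofracM => <-; rewrite mulrA. Qed.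

Lemma laurentD v f g p q :
  laurent v f p -> laurent v g q -> laurent v (f + g) (p + q).
Proof. by rewrite /laurent mulrDr tofracD => -> ->. Qed.

(* The Frobenius number of [H]. *)
Variable F : nat.

Definition res q : K :=
  xget 0 [set k | exists v f, laurent v f q /\ k = f (F + v)%N].

(** Two representations [t^(-v) f] and [t^(-w) g] satisfy [t^v g = t^w f]; comparing coefficients at
    [F + v + w] shows that the choice made by [xget] does not matter. *)
Lemma resE v f q : laurent v f q -> res q = f (F + v)%N.
Proof.
move=> vfq; rewrite /res; case: xgetP => [_ _ [w [g [wgq ->]]]|/(_ (f (F + v)%N))].
  have : fpsX K v * g = fpsX K w * f.
    apply: tofrac_inj; rewrite -(laurentX v wgq).
    by rewrite addnC (laurentX w vfq).
  move/(congr1 (fun f : fps K => f (F + v + w)%N)).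
  rewrite !fpsXM leq_addl addnK [(F + v)%N]addnC -addnA leq_addr addnC addnK.
  by rewrite addnC.
by case; exists v, f.
Qed.

Lemma resD p q : res (p + q) = res p + res q.
Proof.
have [v [f vfp]] := laurent_ex p; have [w [g wgq]] := laurent_ex q.
have vp := laurentX w vfp; have := laurentX v wgq; rewrite addnC => wq.
by rewrite (resE (laurentD vp wq)) (resE vp) (resE wq).
Qed.

Lemma sr_frac_dual_subproof q :
  (fun x : R => res (tofrac (sr_fps x) * q)) \in @continuous_functional K H.
Proof.
have [v [f vfq]] := laurent_ex q.
apply/asboolP; split=> [x y|c x|].
- by rewrite sr_fpsD tofracD mulrDl resD.
- by rewrite !(resE (laurentM _ vfq)) sr_fpsM srCE -mulrA fpsCM.
- exists (F + v).+1 => x xge; rewrite (resE (laurentM _ vfq)).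
  by apply: (@ord_geM _ (F + v).+1 0) => //; rewrite addn0.
Qed.

Definition sr_frac_dual (q : sr_frac K H) : sr_dual K H :=
  SrDual (sr_frac_dual_subproof q).

Lemma sr_frac_dualE q (x : R) :
  sr_frac_dual q x = res (tofrac (sr_fps x) * q).
Proof. by []. Qed.

Lemma sr_frac_dual_linear : linear sr_frac_dual.
Proof.
move=> a p q; apply: sr_dualP => x.
rewrite sr_dualD sr_dualZ !sr_frac_dualE -resD sr_fracZ sr_fpsM tofracM.
by rewrite mulrDr mulrA [tofrac (sr_fps x) * tofrac (sr_fps a)]mulrC.
Qed.

HB.instance Definition _ := GRing.isLinear.Build R (sr_frac K H) (sr_dual K H)
  *:%R sr_frac_dual sr_frac_dual_linear.

Definition sr_tofrac (x : R^o) : sr_frac K H := tofrac (sr_fps (x : R)).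

Lemma sr_tofrac_linear : linear sr_tofrac.
Proof.
move=> a x y; rewrite /sr_tofrac sr_fpsD tofracD; congr (_ + _).
by rewrite sr_fracZ -tofracM -sr_fpsM.
Qed.

HB.instance Definition _ := GRing.isLinear.Build R R^o (sr_frac K H)
  *:%R sr_tofrac sr_tofrac_linear.

Lemma sr_tofrac_inj : injective sr_tofrac.
Proof. by move=> x y /tofrac_inj/sr_fps_inj. Qed.

(** * Symmetric semigroups: exactness and the Gorenstein property *)

Hypothesis above_F : forall n, (F < n)%N -> H n.
Hypothesis H_symmetric : forall n, (n <= F)%N -> H n <-> ~ H (F - n)%N.

(** Pairing [q] with [t^h] reads off its coefficient at [F - h]. As [h] runs through [H], these
    exponents are, by symmetry, the negative integers and the gaps. *)
Lemma sr_frac_dual_ker q : sr_frac_dual q = 0 <-> exists x : R^o, q = sr_tofrac x.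
Proof.
split=> [dq0|[x ->]]; last first.
  apply: sr_dualP => r; rewrite sr_frac_dualE /sr_tofrac -tofracM -sr_fpsM.
  rewrite (@resE 0 (sr_fps (r * x))) ?addn0; last by rewrite /laurent fpsX0 mul1r.
  rewrite sr_fps_out //; have := H_symmetric (leq0n F); rewrite subn0 => -[+ _].
  by apply; exact: ns_mem0.
have [v [f vfq]] := laurent_ex q.
have coef h : H h -> (h <= F + v)%N -> f (F + v - h)%N = 0.
  move=> Hh hle; have : sr_frac_dual q (srX K H h) = 0 by rewrite dq0.
  by rewrite sr_frac_dualE (resE (laurentM _ vfq)) srXE // fpsXM hle.
(* The exponents [h > F] kill the negative powers of [t] in [q]. *)
have fge : ord_ge v f.
  move=> j jv; have jle : (j <= F + v)%N by rewrite ltnW // ltn_addl.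
  rewrite -(subKn jle); apply: coef; last exact: leq_subr.
  apply: above_F; rewrite -addnBA ?(ltnW jv) // -[ltnLHS]addn0.
  by rewrite ltn_add2l subn_gt0.
pose g : fps K := fun n => f (v + n)%N.
have gH n : ~ H n -> g n = 0.
  move=> nH; have nF : (n <= F)%N by rewrite leqNgt; apply/negP => /above_F.
  have HFn : H (F - n)%N.
    by apply: contrapT => nHF; apply: nH; apply/(H_symmetric nF).
  have := coef _ HFn; rewrite /g; have -> : (F + v - (F - n) = v + n)%N.
    by rewrite addnC -addnBA ?leq_subr // subKn.
  by apply; rewrite (leq_trans (leq_subr _ _)) // leq_addr.
exists (to_sr H g); rewrite /sr_tofrac to_srK //.
apply: (mulfI (tofrac_neq0 (@fpsX_neq0 v))); rewrite vfq -tofracM.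
by congr tofrac; exact: ord_ge_factor.
Qed.

(** The coefficient of [q] at [F - i] has to be [phi (t^i)]. As [phi] vanishes in order at least
    [N], multiplying by [t^N] gives a power series [g]. *)
Lemma sr_frac_dual_surj (phi : sr_dual K H) : exists q, phi = sr_frac_dual q.
Proof.
have [N phi0] := sr_dual_bound phi.
pose g : fps K := fun n => if (n <= F + N)%N then phi (srX K H (F + N - n)) else 0.
exists (tofrac g / tofrac (fpsX K N)); apply: sr_dualP => x.
have gq : laurent N g (tofrac g / tofrac (fpsX K N)).
  by rewrite /laurent mulrCA mulfV ?mulr1 //; apply/tofrac_neq0/fpsX_neq0.
rewrite sr_frac_dualE (resE (laurentM _ gq)) fpsM.
rewrite (@sr_dual_expand _ _ phi (F + N).+1); last first.
  by move=> y yge; apply: phi0; apply: ord_ge_le yge; rewrite ltnW // ltnS leq_addl.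
apply: eq_bigr => i _; rewrite /g leq_subr subKn //.
by rewrite -ltnS.
Qed.

(** ['rV[R]_0] serves as the zero module. *)
Let resolution_module (i : nat) : lmodType R :=
  match i with
  | 0 => sr_frac K H
  | 1 => sr_dual K H
  | _ => 'rV[R]_0
  end.

Let resolution_map (i : nat) :
    {linear resolution_module i -> resolution_module i.+1} :=
  match i with
  | 0 => (sr_frac_dual : {linear sr_frac K H -> sr_dual K H})
  | _ => \0
  end.

Theorem sr_gorenstein : gorenstein_local_ring R.
Proof.
split; first exact: sr_noetherian above_F.
  by exists (@sr_max K H); exact: sr_local.
exists resolution_module, (sr_tofrac : {linear R^o -> sr_frac K H}),
  resolution_map; split; last first.
  exists 1%N => -[|[|i]] // _ y; exact: thinmx0.
split.
- case=> [|[|i]].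
  + exact: sr_frac_injective.
  + exact: sr_dual_injective above_F.
  + move=> M N j f _; exists \0 => x; rewrite thinmx0; symmetry; exact: thinmx0.
- exact: sr_tofrac_inj.
- exact: sr_frac_dual_ker.
- case=> [|i] y; split=> // _.
  + by have [q ->] := sr_frac_dual_surj y; exists q.
  + exists 0; rewrite [y]thinmx0; symmetry; exact: thinmx0.
Qed.

End Fractions.

(** * The semigroup [S_e] *)

Section SallySemigroup.
Variables (K : fieldType) (e : nat).
Hypothesis he : (4 <= e)%N.
Local Notation R := (semigroup_ring K (S_ e)).
Local Notation m := (@sr_max K (S_ e)).

(** * Membership, symmetry and gap count *)

Definition in_S (n : nat) : bool :=
  (n == 0)%N || [&& e <= n, n != e + 2, n != e + 3 & n != 2 * e + 3]%N.

(** For the converse, [n >= 2 e] reduces to [n - e], unless this is a gap. That happens only for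
    [n = 2 e + 2] and [n = 3 e + 3], where [n - e - 1] is [e + 1] or [2 e + 2]. *)
Lemma S_memP n : S_ e n <-> in_S n.
Proof.
split.
  case=> s [sA ->]; elim: s sA => [//|a s IH] sA.
  have /IH : forall b, b \in s -> [set i | (e <= i <= 2 * e - 1)%N /\
      i <> (e + 2)%N /\ i <> (e + 3)%N] b.
    by move=> b bs; apply: sA; rewrite inE bs orbT.
  have [/andP[ea ae] [a2 a3]] := sA a (mem_head _ _).
  by rewrite /in_S /=; lia.
have gen i : (e <= i < 2 * e)%N -> i <> (e + 2)%N -> i <> (e + 3)%N -> S_ e i.
  move=> ie i2 i3; exists [:: i]; split; last by rewrite /= addn0.
  by move=> a; rewrite inE => /eqP ->; split=> //; lia.
elim/ltn_ind: n => n IH nS.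
have [->|n0] := eqVneq n 0%N; first exact: ns_mem0.
have [lt|ge] := ltnP n (2 * e)%N.
  by apply: gen; move: nS n0; rewrite /in_S; lia.
have add g : (e <= g < e + 2)%N -> in_S (n - g) -> S_ e n.
  move=> ge1 ngS; rewrite -(@subnKC g n); last by lia.
  by apply: ns_memD; [apply: gen; lia | apply: IH => //; lia].
have [h|nh] := boolP (in_S (n - e)); first by apply: (add e) => //; lia.
apply: (add e.+1); first lia.
by move: nS nh ge; rewrite /in_S; lia.
Qed.

Lemma S_above n : (2 * e + 3 < n)%N -> S_ e n.
Proof. by move=> h; apply/S_memP; rewrite /in_S; lia. Qed.

Lemma S_symmetric n : (n <= 2 * e + 3)%N -> S_ e n <-> ~ S_ e (2 * e + 3 - n)%N.
Proof.
move=> h; rewrite !S_memP; split=> [nS|/negP].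
  by apply/negP; move: nS; rewrite /in_S; lia.
by rewrite /in_S; lia.
Qed.

Lemma S_count N : (2 * e + 4 <= N)%N ->
  (\sum_(i < N) `[< S_ e i >] = N - (e + 2))%N.
Proof.
(* The summands count the elements below [M] in [{0}], [[e, e + 1]], [[e + 4, 2 e + 2]] and from
   [2 e + 4] on, by truncated subtraction. *)
have cE M : (\sum_(i < M) `[< S_ e i >] = minn M 1 + minn (M - e) 2 +
    minn (M - (e + 4)) (e - 1) + (M - (2 * e + 4)))%N.
  elim: M => [|M IH]; first by rewrite big_ord0; lia.
  rewrite big_ord_recr /= IH; have -> : `[< S_ e M >] = in_S M.
    by apply/asboolP/idP => /S_memP.
  by rewrite /in_S; lia.
by rewrite cE; lia.
Qed.

(** * Powers of the maximal ideal *)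

Lemma S_max_ord_ge x : m x -> ord_ge e (sr_fps x).
Proof.
move=> mx [|i] ie; first exact: mx.
by apply: sr_fps_out => /S_memP; rewrite /in_S; lia.
Qed.

Lemma S_monomial_max k : S_ e k -> (0 < k)%N -> m (srX K (S_ e) k).
Proof.
by move=> Hk k0; apply/sr_maxE; rewrite srXE // /fpsX eq_sym eqn0Ngt k0.
Qed.

Lemma S_monomial_pow n k : S_ e k -> (n * e <= k)%N ->
  ideal_pow m n (srX K (S_ e) k).
Proof.
elim: n k => [|n IH] k Hk nk; first exact: ideal_pow0.
suff [g [g0 gk Hg Hkg]] : exists g, [/\ (0 < g)%N, (n * e + g <= k)%N, S_ e g &
    S_ e (k - g)%N].
  have gk' : (g <= k)%N by apply: leq_trans gk; exact: leq_addl.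
  rewrite -(subnKC gk') srXD //; apply: ideal_powS; first exact: S_monomial_max.
  by apply: IH => //; rewrite leq_subRL // addnC.
case: n {IH} nk => [|n] nk.
  by exists k; rewrite subnn; split; [lia|lia|exact: Hk|exact: ns_mem0].
have [Hke|nHke] := pselect (S_ e (k - e)%N).
  exists e; split=> //; [lia|lia|apply/S_memP; rewrite /in_S; lia].
(* As [k - e] is a gap, [k] is [2 e + 2] or [3 e + 3]. Because [4 e > 3 e + 3], the largest multiple
   of [e] up to [k] leaves a remainder of at least [2], so removing [e + 1] keeps the bound. *)
exists e.+1; split; first lia.
- move: Hk => /S_memP; have /negP := contra_not (S_memP (k - e)).2 nHke.
  have [|] := leqP n 1; first by case: n nk => [|[|]] // nk _; rewrite /in_S; lia.
  move=> n1; have : (4 * e <= k)%N.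
    by apply: leq_trans nk; rewrite leq_mul2r; lia.
  by rewrite /in_S; lia.
- by apply/S_memP; rewrite /in_S; lia.
- apply/S_memP; move: Hk => /S_memP.
  have /negP := contra_not (S_memP (k - e)).2 nHke.
  have : (2 * e <= k)%N by apply: leq_trans nk; rewrite leq_mul2r; lia.
  by rewrite /in_S; lia.
Qed.

(** One inclusion adds orders, each element of [m] having order at least [e]. For the other, the
    power contains all monomials of [S_e] from [n e] on, and it is open because it is nonzero. *)
Lemma S_max_pow n : ideal_pow m n = @sr_ord_ge K (S_ e) (n * e).
Proof.
apply/seteqP; split.
  apply: ideal_pow_min; first exact: sr_ord_ge_ideal.
  elim: n => [|n IH] g gm; first by rewrite big_ord0.
  rewrite big_ord_recl sr_ord_geE sr_fpsM mulSn; apply: ord_geM.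
    exact: S_max_ord_ge.
  by apply: IH => i; exact: gm.
have powid := ideal_pow_ideal m n.
set k := (n * e + 2 * e + 4)%N.
have Hk : S_ e k by apply: S_above; lia.
have Xk : ideal_pow m n (srX K (S_ e) k) by apply: S_monomial_pow => //; lia.
have [|L IL] := ideal_open S_above powid Xk.
  move/(congr1 (fun x : R => sr_fps x k))/eqP.
  by rewrite sr_fps0 srXE // /fpsX eqxx oner_eq0.
by apply: (ideal_of_monomials powid IL) => j nj Hj; apply: S_monomial_pow.
Qed.

(** * Embedding dimension and multiplicity *)

Definition S_gen (i : nat) : nat := if (i < 2)%N then (e + i)%N else (e + i + 2)%N.

Lemma S_gen_mem (i : 'I_(e - 2)) : S_ e (S_gen i).
Proof.
case: i => [i ie]; apply/S_memP; rewrite /in_S /S_gen /=.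
by case: ifP; lia.
Qed.

Lemma S_gen_lt (i : 'I_(e - 2)) : (e <= S_gen i < 2 * e)%N.
Proof. by case: i => [i ie]; rewrite /S_gen /=; case: ifP; lia. Qed.

Lemma S_gen_inj (i j : 'I_(e - 2)) : S_gen i = S_gen j -> i = j.
Proof.
case: i j => [i ie] [j je] eq; apply: val_inj; move: eq; rewrite /S_gen /=.
by do 2!case: ifP; lia.
Qed.

Lemma S_gen_ex n : S_ e n -> (0 < n < 2 * e)%N ->
  exists i : 'I_(e - 2), n = S_gen i.
Proof.
move=> /S_memP nS n2; have [n_small|n_large] := ltnP n (e + 2).
  have lt : (n - e < e - 2)%N by move: nS n2; rewrite /in_S; lia.
  by exists (Ordinal lt); move: nS n2; rewrite /S_gen /in_S /=; case: ifP; lia.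
have lt : (n - e - 2 < e - 2)%N by move: nS n2; rewrite /in_S; lia.
by exists (Ordinal lt); move: nS n2; rewrite /S_gen /in_S /=; case: ifP; lia.
Qed.

(** Modulo [m^2], the series of order at least [2 e], only coefficients below [2 e] count, and there
    the nonzero exponents in [S_e] are the generators. *)
Lemma S_embedding_dim : embedding_dim R (e - 2).
Proof.
exists m; split; first exact: sr_local.
exists (fun i => srX K (S_ e) (S_gen i)); split.
- by move=> i; apply: S_monomial_max; [exact: S_gen_mem | have := S_gen_lt i; lia].
- move=> y /sr_maxE y0; exists (fun i => srC (S_ e) (sr_fps y (S_gen i))).
  rewrite S_max_pow => n n2; rewrite sr_fpsB fpsB sr_fps_sum fps_sum.
  rewrite (eq_bigr (fun i : 'I_(e - 2) => sr_fps y (S_gen i) * (n == S_gen i)%:R));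
    last by move=> i _; exact: sr_fps_monomial.
  have [[i ->]|noi] := pselect (exists i : 'I_(e - 2), n = S_gen i).
    rewrite (bigD1 i) //= eqxx mulr1 big1 ?addr0 ?subrr // => j /eqP ji.
    by case: eqP => [/S_gen_inj /esym//|_]; rewrite mulr0.
  rewrite big1 ?subr0 => [|i _]; last first.
    by case: eqP => [ni|_]; [case: noi; exists i | rewrite mulr0].
  case: (posnP n) => [-> //|n0]; apply: sr_fps_out => nS.
  by apply: noi; apply: S_gen_ex => //; rewrite n0.
- move=> a; rewrite S_max_pow => sge i; apply/sr_maxE.
  have := sge (S_gen i); have /andP[_ ->] := S_gen_lt i => /(_ isT).
  rewrite sr_fps_sum fps_sum (eq_bigr (fun j : 'I_(e - 2) =>
    if (S_gen j <= S_gen i)%N then sr_fps (a j) (S_gen i - S_gen j)%N else 0));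
    last first.
    by move=> j _; rewrite mulrC sr_fpsM srXE ?fpsXM //; exact: S_gen_mem.
  rewrite (bigD1 i) //= leqnn subnn big1 ?addr0 // => j /eqP ji.
  (* Distinct generators differ by less than [e], so the difference is a gap and only the constant
     term of [a i] survives. *)
  case: leqP => // le; apply: sr_fps_out => /S_memP.
  have neq : S_gen j <> S_gen i by move/S_gen_inj.
  by have := S_gen_lt i; have := S_gen_lt j; rewrite /in_S; lia.
Qed.

Lemma S_multiplicity : multiplicity R e.
Proof.
exists m, 1%N; split; [exact: sr_local | exact: sr_krull_dim S_above |].
have e0 : (e%:R : rat) != 0 by rewrite Num.Theory.pnatr_eq0; lia.
have sz : size ((e%:R)%:P * 'X + (- 2)%:P : {poly rat}) = 2%N.
  by rewrite size_MXaddC polyC_eq0 (negbTE e0) /= size_polyC e0.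
exists ((e%:R)%:P * 'X + (- 2)%:P); split; first exact: sz.
  by rewrite lead_coefE sz /= coefD coefMX !coefC /= addr0 mul1r.
(* For [n >= 3], [(n + 1) e >= 2 e + 4], so [S_count] applies. *)
exists 3%N => n n3; exists (n * e - 2)%N; last first.
  have le : (2 <= n * e)%N by nia.
  by rewrite natrB // natrM !hornerE mulrC.
rewrite S_max_pow.
have -> : (n * e - 2 = \sum_(i < n.+1 * e) `[< S_ e i >])%N.
  by rewrite S_count; nia.
exact: quotient_length_sr_ord_ge.
Qed.

Theorem S_sally : sally_semigroup K (S_ e).
Proof.
split; first exact: sr_gorenstein S_above S_symmetric.
exists (e - 2)%N, 1%N, e; split=> //; last by lia.
- exact: S_embedding_dim.
- exact: sr_krull_dim S_above.
- exact: S_multiplicity.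
Qed.

End SallySemigroup.

Theorem mainTheorem5 (K : fieldType) (e : nat) (he : (4 <= e)%N) :
  (sally_semigroup K (S_ e) /\ semigroup_multiplicity K (S_ e) e) /\
  (exists H : numerical_semigroup,
     sally_semigroup K H /\ semigroup_multiplicity K H e).
Proof.
have Se : sally_semigroup K (S_ e) /\ semigroup_multiplicity K (S_ e) e.
  by split; [exact: S_sally | exact: S_multiplicity].
by split; last exists (S_ e).
Qed.
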